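(* Let $U$ be a topological group admitting a continuous open non-surjective monomorphism $\varphi\colon U\hookrightarrow U$. Suppose $\langle X\mid R\rangle$ is an abstract group presentation with $X$ finite but with $R$ containing a relator $x^n$ for some $n\in\mathbb{Z}_{\ge2}$ and some $x\in X$. Then $\langle X\mid R\rangle$ is not generalisable over $\varphi$.
   Context: All topological groups are Hausdorff. A continuous open monomorphism is an injective group homomorphism that is continuous and open. For a finite set $X$, $\mathcal{H}_X(\varphi)=(U*F(X))/\langle\langle tut^{-1}\varphi(u)^{-1}\mid t\in X,u\in U\rangle\rangle$, endowed with the unique group topology making the canonical embedding $U\hookrightarrow\mathcal{H}_X(\varphi)$ continuous and open, and $G_\varphi:=\mathcal{H}_X(\varphi)/\langle\langle R\rangle\rangle$ with the quotient topology. The presentation $\langle X\mid R\rangle$ is generalisable over $\varphi$ if the composite $U\hookrightarrow\mathcal{H}_X(\varphi)\twoheadrightarrow G_\varphi$ is injective. *)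

(* Defs.v *)
From HB Require Import structures.
From mathcomp Require Import all_boot.
From mathcomp Require Import all_classical topology.

Set Implicit Arguments.
Unset Strict Implicit.
Unset Printing Implicit Defensive.

Import Algebra.

Local Open Scope classical_set_scope.
Local Open Scope quotient_scope.
Local Open Scope group_scope.

Lemma group_morph (G H : groupType) (f : G -> H) :
  {morph f : x y / x * y} -> monoid_morphism f.
Proof.
by move=> fM; split=> //; apply: (mulgI (f 1)); rewrite -fM !mulg1.
Qed.

(* The relators are given as pairs of words that are to be identified. *)
Record word_pres := WordPres {
  letter :> choiceType;
  linv : letter -> letter;
  lrel : seq letter -> seq letter -> Prop;
}.

Inductive word_equiv (P : word_pres) : seq P -> seq P -> Prop :=
| we_refl w : word_equiv w w
| we_sym v w : word_equiv v w -> word_equiv w v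
| we_trans u v w : word_equiv u v -> word_equiv v w -> word_equiv u w
| we_cancel p q t : word_equiv (p ++ t :: linv t :: q) (p ++ q)
| we_cancelV p q t : word_equiv (p ++ linv t :: t :: q) (p ++ q)
| we_rel p q v w : lrel v w -> word_equiv (p ++ v ++ q) (p ++ w ++ q).

Section WordGroup.
Variable P : word_pres.
Implicit Types u v w p q : seq P.

Lemma word_equiv_ctx p q v w :
  word_equiv v w -> word_equiv (p ++ v ++ q) (p ++ w ++ q).
Proof.
move=> vw.
elim: v w / vw => [w|v w _|u v w _ IH _|p' q' t|p' q' t|p' q' v w r].
- exact: we_refl.
- exact: we_sym.
- exact: we_trans IH.
- by rewrite -!catA !cat_cons !catA -!(catA (p ++ p')); apply: we_cancel.
- by rewrite -!catA !cat_cons !catA -!(catA (p ++ p')); apply: we_cancelV.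
- by rewrite -!catA !(catA p p'); apply: we_rel.
Qed.

Lemma word_equiv_cat v v' w w' :
  word_equiv v v' -> word_equiv w w' -> word_equiv (v ++ w) (v' ++ w').
Proof.
move=> vv' ww'; apply: (@we_trans _ _ (v' ++ w)).
  exact: (@word_equiv_ctx [::] w v v').
by have := @word_equiv_ctx v' [::] w w' ww'; rewrite !cats0.
Qed.

Let weq v w := `[< word_equiv v w >].

Let weq_refl : reflexive weq.
Proof. by move=> w; apply/asboolP/we_refl. Qed.

Let weq_sym : symmetric weq.
Proof. by move=> v w; apply/asboolP/asboolP; apply: we_sym. Qed.

Let weq_trans : transitive weq.
Proof.
by move=> v u w /asboolP uv /asboolP vw; apply/asboolP; apply: we_trans vw.
Qed.

Definition word_eqr := EquivRel weq weq_refl weq_sym weq_trans.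

Definition word_group := {eq_quot word_eqr}.
HB.instance Definition _ := Choice.on word_group.
HB.instance Definition _ := EqQuotient.on word_group.

Lemma word_piP v w :
  (\pi_word_group v = \pi_word_group w) <-> word_equiv v w.
Proof. by split=> [/eqmodP /asboolP|?] //; apply/eqmodP/asboolP. Qed.

Lemma word_reprP w : word_equiv (repr (\pi_word_group w)) w.
Proof. by apply/word_piP; rewrite reprK. Qed.

Definition wmul (x y : word_group) : word_group :=
  \pi_word_group (repr x ++ repr y).
Definition winv (x : word_group) : word_group :=
  \pi_word_group (rev (map (@linv P) (repr x))).

Lemma wmul_pi v w :
  wmul (\pi_word_group v) (\pi_word_group w) = \pi_word_group (v ++ w).
Proof. by apply/word_piP/word_equiv_cat; apply: word_reprP. Qed.

Let wmulA : associative wmul.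
Proof.
move=> x y z; rewrite -[x]reprK -[y]reprK -[z]reprK.
by rewrite (wmul_pi (repr y)) (wmul_pi (repr x) (repr y)) !wmul_pi catA.
Qed.

Let wmul1 : left_id (\pi_word_group [::]) wmul.
Proof. by move=> x; rewrite -[x in LHS]reprK wmul_pi reprK. Qed.

Let wmulr1 : right_id (\pi_word_group [::]) wmul.
Proof. by move=> x; rewrite -[x in LHS]reprK wmul_pi cats0 reprK. Qed.

Let wmulV : left_inverse (\pi_word_group [::]) winv wmul.
Proof.
move=> x; rewrite -[x in X in wmul _ X]reprK wmul_pi; apply/word_piP.
elim: (repr x) => [|t w IH]; first exact: we_refl.
rewrite map_cons rev_cons cat_rcons.
by apply: we_trans IH; apply: we_cancelV.
Qed.

Let wmulVr : right_inverse (\pi_word_group [::]) winv wmul.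
Proof.
move=> x; rewrite -[x in X in wmul X _]reprK wmul_pi; apply/word_piP.
elim/last_ind: (repr x) => [|w t IH]; first exact: we_refl.
rewrite map_rcons rev_rcons cat_rcons.
by apply: we_trans IH; apply: we_cancel.
Qed.

HB.instance Definition _ :=
  isGroup.Build word_group wmulA wmul1 wmulr1 wmulV wmulVr.

Definition wletter (t : P) : word_group := \pi_word_group [:: t].

Lemma word_mulE v w :
  \pi_word_group v * \pi_word_group w = \pi_word_group (v ++ w).
Proof. exact: wmul_pi. Qed.

Lemma word_group_ind (Q : word_group -> Prop) :
  Q 1 -> (forall t x, Q x -> Q (wletter t * x)) -> forall x, Q x.
Proof.
move=> Q1 QM x; rewrite -[x]reprK; elim: (repr x) => [|t w IH] //.
by rewrite -cat1s -word_mulE; apply: QM.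
Qed.

End WordGroup.

Section FreeGroup.
Variable X : choiceType.

(* [(x, true)] stands for [x] and [(x, false)] for its formal inverse. *)
Definition free_pres :=
  @WordPres (X * bool)%type (fun t => (t.1, ~~ t.2)) (fun _ _ => False).

Definition free_group := word_group free_pres.
HB.instance Definition _ := Group.on free_group.

Definition fgen (x : X) : free_group := @wletter free_pres (x, true).

Lemma fgenV x : (fgen x)^-1 = @wletter free_pres (x, false).
Proof.
apply: (mulgI (fgen x)); rewrite mulgV; apply/esym.
rewrite [LHS]word_mulE; apply/word_piP.
exact: (@we_cancel free_pres [::] [::] (x, true)).
Qed.

Lemma free_group_ind (Q : free_group -> Prop) :
  Q 1 -> (forall x f, Q f -> Q (fgen x * f)) ->
  (forall x f, Q f -> Q ((fgen x)^-1 * f)) -> forall f, Q f.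
Proof.
move=> Q1 QM QV; apply: word_group_ind => // -[x []] f Qf; first exact: QM.
by rewrite -fgenV; apply: QV.
Qed.

End FreeGroup.

Section FreeProduct.
Variables G H : groupType.

Inductive fprod_rel : seq (G + H) -> seq (G + H) -> Prop :=
| fprod_rel1l : fprod_rel [:: inl 1] [::]
| fprod_rel1r : fprod_rel [:: inr 1] [::]
| fprod_relMl a b : fprod_rel [:: inl a; inl b] [:: inl (a * b)]
| fprod_relMr a b : fprod_rel [:: inr a; inr b] [:: inr (a * b)].

Definition fprod_pres := @WordPres (G + H)%type
  (fun t => match t with inl a => inl a^-1 | inr b => inr b^-1 end) fprod_rel.

Definition free_product := word_group fprod_pres.
HB.instance Definition _ := Group.on free_product.

Definition fprodl (a : G) : free_product := @wletter fprod_pres (inl a).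
Definition fprodr (b : H) : free_product := @wletter fprod_pres (inr b).

Let fprodlM : {morph fprodl : a b / a * b}.
Proof.
move=> a b; rewrite [RHS]word_mulE; apply/esym/word_piP.
exact: (@we_rel fprod_pres [::] [::] _ _ (fprod_relMl a b)).
Qed.

Let fprodrM : {morph fprodr : a b / a * b}.
Proof.
move=> a b; rewrite [RHS]word_mulE; apply/esym/word_piP.
exact: (@we_rel fprod_pres [::] [::] _ _ (fprod_relMr a b)).
Qed.

HB.instance Definition _ :=
  isUMagmaMorphism.Build G free_product fprodl (group_morph fprodlM).
HB.instance Definition _ :=
  isUMagmaMorphism.Build H free_product fprodr (group_morph fprodrM).

Lemma free_product_ind (Q : free_product -> Prop) :
  Q 1 -> (forall a x, Q x -> Q (fprodl a * x)) ->
  (forall b x, Q x -> Q (fprodr b * x)) -> forall x, Q x.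
Proof.
by move=> Q1 Ql Qr; apply: word_group_ind => // -[a|b] x; [apply: Ql|apply: Qr].
Qed.

End FreeProduct.

Definition normal_subgroup (G : groupType) (N : set G) :=
  [/\ N 1, forall x y, N x -> N y -> N (x / y) & forall x g, N x -> N (x ^ g)].

Definition normal_closure (G : groupType) (S : set G) : set G :=
  \bigcap_(N in [set N | normal_subgroup N /\ S `<=` N]) N.

Section NormalQuotient.
Variables (G : groupType) (S : set G).

Lemma normal_closure_normal : normal_subgroup (normal_closure S).
Proof.
split.
- by move=> N [[]].
- move=> x y Nx Ny N SN; have [[_ NF _] _] := SN.
  by apply: NF; [apply: Nx|apply: Ny].
- by move=> x g Nx N SN; have [[_ _ NJ] _] := SN; apply: NJ; apply: Nx.
Qed.

Lemma sub_normal_closure : S `<=` normal_closure S.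
Proof. by move=> x Sx N [_]; apply. Qed.

Let nc1 : normal_closure S 1. Proof. by case: normal_closure_normal. Qed.
Let ncV x : normal_closure S x -> normal_closure S x^-1.
Proof.
by case: normal_closure_normal => _ NF _ Nx; rewrite -[x^-1]mul1g; apply: NF.
Qed.
Let ncM x y :
  normal_closure S x -> normal_closure S y -> normal_closure S (x * y).
Proof.
case: normal_closure_normal => _ NF _ Nx Ny.
by rewrite -[y]invgK; apply: NF => //; apply: ncV.
Qed.

Let neq x y := `[< normal_closure S (x^-1 * y) >].

Let neq_refl : reflexive neq.
Proof. by move=> x; apply/asboolP; rewrite mulVg. Qed.

Let neq_sym : symmetric neq.
Proof.
by move=> x y; apply/asboolP/asboolP => /ncV; rewrite invgM invgK.
Qed.

Let neq_trans : transitive neq.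
Proof.
move=> y x z /asboolP xy /asboolP yz; apply/asboolP.
by have := ncM xy yz; rewrite mulgA mulgK.
Qed.

Definition nquot_eqr := EquivRel neq neq_refl neq_sym neq_trans.

Definition nquot := {eq_quot nquot_eqr}.
HB.instance Definition _ := Choice.on nquot.
HB.instance Definition _ := EqQuotient.on nquot.

Lemma nquot_piP x y :
  \pi_nquot x = \pi_nquot y <-> normal_closure S (x^-1 * y).
Proof. by split=> [/eqmodP /asboolP|?] //; apply/eqmodP/asboolP. Qed.

Definition nmul (x y : nquot) : nquot := \pi_nquot (repr x * repr y).
Definition ninv (x : nquot) : nquot := \pi_nquot (repr x)^-1.

Lemma nmul_pi x y : nmul (\pi_nquot x) (\pi_nquot y) = \pi_nquot (x * y).
Proof.
case: normal_closure_normal => _ _ NJ.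
rewrite /nmul; set a := repr _; set b := repr _.
have /nquot_piP ax : \pi_nquot a = \pi_nquot x by rewrite reprK.
have /nquot_piP by_ : \pi_nquot b = \pi_nquot y by rewrite reprK.
apply/nquot_piP; rewrite invgM.
have := ncM (NJ _ b ax) by_.
by rewrite conjgE !mulgA mulgK.
Qed.

Lemma ninv_pi x : ninv (\pi_nquot x) = \pi_nquot x^-1.
Proof.
case: normal_closure_normal => _ _ NJ.
rewrite /ninv; set a := repr _.
have /nquot_piP ax : \pi_nquot a = \pi_nquot x by rewrite reprK.
apply/nquot_piP; rewrite invgK.
have := NJ _ a^-1 (ncV ax).
by rewrite conjgE invgM !invgK !mulgA mulgK.
Qed.

Let nmulA : associative nmul.
Proof.
move=> x y z; rewrite -[x]reprK -[y]reprK -[z]reprK.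
by rewrite (nmul_pi (repr y)) (nmul_pi (repr x) (repr y)) !nmul_pi mulgA.
Qed.
Let nmul1 : left_id (\pi_nquot 1) nmul.
Proof. by move=> x; rewrite -[x]reprK nmul_pi mul1g. Qed.
Let nmulr1 : right_id (\pi_nquot 1) nmul.
Proof. by move=> x; rewrite -[x]reprK nmul_pi mulg1. Qed.
Let nmulV : left_inverse (\pi_nquot 1) ninv nmul.
Proof. by move=> x; rewrite -[x]reprK ninv_pi nmul_pi mulVg. Qed.
Let nmulVr : right_inverse (\pi_nquot 1) ninv nmul.
Proof. by move=> x; rewrite -[x]reprK ninv_pi nmul_pi mulgV. Qed.

HB.instance Definition _ := isGroup.Build nquot nmulA nmul1 nmulr1 nmulV nmulVr.

Definition nproj (x : G) : nquot := \pi_nquot x.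

Let nprojM : {morph nproj : x y / x * y}.
Proof. by move=> x y; rewrite [RHS]nmul_pi. Qed.
HB.instance Definition _ :=
  isUMagmaMorphism.Build G nquot nproj (group_morph nprojM).

Lemma nprojP x y : nproj x = nproj y <-> normal_closure S (x^-1 * y).
Proof. exact: nquot_piP. Qed.

Lemma nproj_surj x : exists y, x = nproj y.
Proof. by exists (repr x); rewrite /nproj reprK. Qed.

End NormalQuotient.

Arguments nquot {G} S.
Arguments nproj {G} S x.

#[short(type="preTopologicalGroupType")]
HB.structure Definition PreTopologicalGroup := {G of Topological G & Group G}.

HB.mixin Record PreTopologicalGroup_isTopologicalGroup G
    of PreTopologicalGroup G := {
  mulg_continuous : continuous (fun x : G * G => (x.1 * x.2 : G)) ;
  invg_continuous : continuous (fun x : G => (x^-1 : G)) ;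
}.

#[short(type="topologicalGroupType")]
HB.structure Definition TopologicalGroup :=
  {G of PreTopologicalGroup G & PreTopologicalGroup_isTopologicalGroup G}.

HB.mixin Record isContOpenMono (G H : topologicalGroupType) (f : G -> H) := {
  mono_inj : injective f ;
  mono_continuous : continuous f ;
  mono_open : forall A : set G, open A -> open (f @` A) ;
}.

#[short(type="contOpenMono")]
HB.structure Definition ContOpenMono (G H : topologicalGroupType) :=
  {f of @UMagmaMorphism G H f & isContOpenMono G H f}.

(* Quotient topology.  It is not taken from [quotient_topology], which comes
   with another choice structure on the same carrier. *)
Section NormalQuotientTopology.
Variables (G : preTopologicalGroupType) (S : set G).

Definition nquot_open (A : set (nquot S)) := open (nproj S @^-1` A).

Let nquot_openT : nquot_open setT.
Proof. by rewrite /nquot_open preimage_setT; apply: openT. Qed.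
Let nquot_openI : setI_closed nquot_open.
Proof.
by move=> A B oA oB; rewrite /nquot_open preimage_setI; apply: openI.
Qed.
Let nquot_open_bigU (I : Type) (f : I -> set (nquot S)) :
  (forall i, nquot_open (f i)) -> nquot_open (\bigcup_i f i).
Proof.
move=> fo; rewrite /nquot_open preimage_bigcup.
by apply: bigcup_open => i _; apply: fo.
Qed.

HB.instance Definition _ := isOpenTopological.Build (nquot S)
  nquot_openT nquot_openI nquot_open_bigU.

End NormalQuotientTopology.

Section TopologicalGroupTheory.
Variable G : topologicalGroupType.

Lemma mulgl_continuous (a : G) : continuous (fun x : G => (a * x : G)).
Proof.
move=> x; apply: (@continuous_comp _ _ _ (fun y : G => (a, y))
  (fun z : G * G => z.1 * z.2)); last exact: mulg_continuous.
by apply: cvg_pair; [apply: cvg_cst|apply: cvg_id].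
Qed.

Lemma mulgr_continuous (a : G) : continuous (fun x : G => (x * a : G)).
Proof.
move=> x; apply: (@continuous_comp _ _ _ (fun y : G => (y, a))
  (fun z : G * G => z.1 * z.2)); last exact: mulg_continuous.
by apply: cvg_pair; [apply: cvg_id|apply: cvg_cst].
Qed.

Lemma mulgl_open (a : G) (A : set G) :
  open A -> open [set x | A (a * x)].
Proof. by move=> oA; apply: open_comp => // x _; apply: mulgl_continuous. Qed.

Lemma mulgr_open (a : G) (A : set G) :
  open A -> open [set x | A (x * a)].
Proof. by move=> oA; apply: open_comp => // x _; apply: mulgr_continuous. Qed.

Lemma invg_open (A : set G) : open A -> open [set x : G | A x^-1].
Proof. by move=> oA; apply: open_comp => // x _; apply: invg_continuous. Qed.

End TopologicalGroupTheory.

Section NormalQuotientTopologicalGroup.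
Variables (G : topologicalGroupType) (S : set G).

Lemma nproj_continuous : continuous (nproj S).
Proof. by apply/continuousP => A oA; exact: oA. Qed.

Lemma nproj_open (A : set G) : open A -> open (nproj S @` A).
Proof.
move=> oA; rewrite /open /= /nquot_open.
suff -> : nproj S @^-1` (nproj S @` A) =
    \bigcup_(n in normal_closure S) [set x | A (x * n)].
  by apply: bigcup_open => n _; apply: mulgr_open.
apply/seteqP; split=> [x [a Aa /esym/nprojP xa]|x [n Sn Axn]].
  by exists (x^-1 * a) => //=; rewrite mulVKg.
exists (x * n) => //; apply/esym/nprojP.
by rewrite mulKg.
Qed.

Let nquot_mul_continuous :
  continuous (fun x : nquot S * nquot S => (x.1 * x.2 : nquot S)).
Proof.
move=> [x' y'] B /=; have [x ->] := nproj_surj x'; have [y ->] := nproj_surj y'.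
rewrite -gmulfM => /nproj_continuous nB.
have [[V W] /= [nV nW] VWB] := @mulg_continuous G (x, y) _ nB.
exists (nproj S @` V°, nproj S @` W°) => /=.
  split; apply: open_nbhs_nbhs; split.
  - exact/nproj_open/open_interior.
  - by exists x => //; exact: nV.
  - exact/nproj_open/open_interior.
  - by exists y => //; exact: nW.
move=> [_ _] [/= [v Vv <-] [w Ww <-]]; rewrite -gmulfM.
by apply: (VWB (v, w)); split; apply: interior_subset.
Qed.

Let nquot_inv_continuous : continuous (fun x : nquot S => (x^-1 : nquot S)).
Proof.
apply/continuousP => A oA; rewrite /open /= /nquot_open.
rewrite (_ : _ @^-1` _ = [set x : G | (nproj S @^-1` A) x^-1]).
  exact: invg_open.
by apply/seteqP; split=> x /=; rewrite gmulfV.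
Qed.

HB.instance Definition _ := PreTopologicalGroup_isTopologicalGroup.Build
  (nquot S) nquot_mul_continuous nquot_inv_continuous.

End NormalQuotientTopologicalGroup.

Section HNN.
Variables (X : finType) (U : topologicalGroupType) (phi : contOpenMono U U).

Local Notation UFX := (free_product U (free_group X)).

Definition hnn_rels : set UFX :=
  [set w | exists (t : X) (u : U),
     w = fprodr _ (fgen t) * fprodl _ u * (fprodr _ (fgen t))^-1
         * (fprodl _ (phi u))^-1].

Definition hnn := nquot hnn_rels.
HB.instance Definition _ := Group.on hnn.

Definition hnn_emb (u : U) : hnn := nproj hnn_rels (fprodl _ u).
Definition hnn_free (f : free_group X) : hnn := nproj hnn_rels (fprodr _ f).

Let hnn_embM : {morph hnn_emb : u v / u * v}.
Proof. by move=> u v; rewrite /hnn_emb !gmulfM. Qed.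
Let hnn_freeM : {morph hnn_free : f g / f * g}.
Proof. by move=> u v; rewrite /hnn_free !gmulfM. Qed.
HB.instance Definition _ :=
  isUMagmaMorphism.Build U hnn hnn_emb (group_morph hnn_embM).
HB.instance Definition _ :=
  isUMagmaMorphism.Build (free_group X) hnn hnn_free (group_morph hnn_freeM).

(* A set is open iff all its left translates have an open trace on U;
   [hnn_emb_continuous], [hnn_emb_open], the topological group structure below
   and [hnn_topology_unique] show that this is the unique group topology making
   [hnn_emb] continuous and open. *)
Definition hnn_open (A : set hnn) :=
  forall h : hnn, open [set u | A (h * hnn_emb u)].

Let hnn_openT : hnn_open setT.
Proof. by move=> h; rewrite (_ : mkset _ = setT) //; apply: openT. Qed.
Let hnn_openI : setI_closed hnn_open.
Proof. by move=> A B oA oB h; apply: openI (oA h) (oB h). Qed.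
Let hnn_open_bigU (I : Type) (f : I -> set hnn) :
  (forall i, hnn_open (f i)) -> hnn_open (\bigcup_i f i).
Proof. by move=> fo h; apply: bigcup_open => i _; apply: fo. Qed.

HB.instance Definition _ := isOpenTopological.Build hnn
  hnn_openT hnn_openI hnn_open_bigU.

Lemma hnn_openE (A : set hnn) : open A = hnn_open A.
Proof. by []. Qed.

Lemma hnn_conj t u :
  hnn_free (fgen t) * hnn_emb u * (hnn_free (fgen t))^-1 = hnn_emb (phi u).
Proof.
apply: divg1_eq; rewrite /hnn_emb /hnn_free -!gmulfV -!gmulfM.
have <- : nproj hnn_rels 1 = 1 by apply: gmulf1.
apply/esym/nprojP; rewrite invg1 mul1g; apply: sub_normal_closure.
by exists t, u; rewrite !gmulfV.
Qed.

Lemma hnn_ind (Q : hnn -> Prop) :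
  Q 1 -> (forall u h, Q h -> Q (hnn_emb u * h)) ->
  (forall t h, Q h -> Q (hnn_free (fgen t) * h)) ->
  (forall t h, Q h -> Q ((hnn_free (fgen t))^-1 * h)) -> forall h, Q h.
Proof.
move=> Q1 QU Qt QtV h; have [w ->] := nproj_surj h.
elim/free_product_ind: w => [|u w Qw|f w Qw].
- by rewrite gmulf1.
- by rewrite gmulfM; apply: QU.
- have -> : nproj hnn_rels (fprodr _ f * w) = hnn_free f * nproj hnn_rels w.
    exact: gmulfM.
  elim/free_group_ind: f => [|t f Qf|t f Qf].
  + by rewrite gmulf1 mul1g.
  + by rewrite hnn_freeM -mulgA; apply: Qt.
  + by rewrite hnn_freeM (gmulfV _ (fgen t)) -mulgA; apply: QtV.
Qed.

Lemma hnn_emb_continuous : continuous hnn_emb.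
Proof.
apply/continuousP => A; rewrite hnn_openE => /(_ 1).
by rewrite (_ : mkset _ = hnn_emb @^-1` A) //; apply/seteqP;
  split=> u /=; rewrite mul1g.
Qed.

Lemma hnn_coset_open (h : hnn) (V : set U) :
  open V -> open [set h * hnn_emb v | v in V].
Proof.
move=> oV; rewrite hnn_openE => h'; rewrite openE => u0 /= [v0 Vv0 e].
have : open [set u | V (v0 * u0^-1 * u)] by apply: mulgl_open.
rewrite openE => /(_ u0) /=; rewrite mulgVK => /(_ Vv0).
apply: filterS => u /= Vu; exists (v0 * u0^-1 * u) => //.
by rewrite !gmulfM gmulfV !mulgA e mulgK.
Qed.

Lemma hnn_emb_open (V : set U) : open V -> open (hnn_emb @` V).
Proof.
move=> /(hnn_coset_open 1); congr open; apply/seteqP.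
by split=> _ [v Vv <-]; exists v; rewrite ?mul1g.
Qed.

Lemma hnn_nbhs_coset (h : hnn) (V : set U) :
  nbhs 1 V -> nbhs h [set h * hnn_emb v | v in V].
Proof.
move=> nV; have := @hnn_coset_open h _ (open_interior V).
rewrite openE => /(_ h) hV.
apply: filterS (hV _); first by move=> _ [v /interior_subset Vv <-]; exists v.
by exists 1 => //; rewrite gmulf1 mulg1.
Qed.

Lemma hnn_nbhsE (h : hnn) (A : set hnn) :
  nbhs h A -> nbhs 1 [set u | A (h * hnn_emb u)].
Proof.
rewrite nbhsE => -[B [oB Bh] BA].
have := oB h; rewrite openE => /(_ 1) /=; rewrite gmulf1 mulg1 => /(_ Bh).
by apply: filterS => u /=; apply: BA.
Qed.

Lemma hnn_conj_nbhs (h : hnn) (V : set U) : nbhs 1 V ->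
  exists2 W : set U, nbhs 1 W &
    forall w, W w -> exists2 v, V v & hnn_emb w ^ h = hnn_emb v.
Proof.
elim/hnn_ind: h V => [|u h IH|t h IH|t h IH] V nV.
- by exists V => // w Vw; exists w; rewrite ?conjg1.
- have [W nW WV] := IH _ nV.
  exists [set w | W (w ^ u)].
    have c : continuous (fun w : U => (u^-1 * (w * u) : U)).
      move=> w; apply: (@continuous_comp _ _ _ (fun w : U => (w * u : U))).
        exact: mulgr_continuous.
      exact: mulgl_continuous.
    by apply: (c 1); rewrite mul1g mulVg.
  by move=> w /= /WV[v Vv e]; exists v => //; rewrite conjgM -gmulfJ.
- have [W nW WV] := IH _ nV.
  exists (phi @` W).
    have : open (phi @` W°) by apply: mono_open; apply: open_interior.
    rewrite openE => /(_ 1) oW.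
    apply: filterS (oW _); first by apply: image_subset; apply: interior_subset.
    by exists 1; rewrite ?gmulf1.
  move=> _ [w /WV[v Vv e] <-]; exists v => //.
  rewrite conjgM -(hnn_conj t).
  by rewrite [X in X ^ h]conjgE !mulgA mulVg mul1g mulgVK.
- have [W nW WV] := IH _ nV.
  exists (phi @^-1` W).
    by apply: (@mono_continuous _ _ phi 1); rewrite gmulf1.
  move=> w /WV[v Vv e]; exists v => //.
  by rewrite conjgM [X in X ^ h]conjgE invgK mulgA hnn_conj.
Qed.

Let hnn_mul_continuous : continuous (fun x : hnn * hnn => (x.1 * x.2 : hnn)).
Proof.
move=> [a b] A /= /hnn_nbhsE nA.
have [|[V W] /= [nV nW] VWA] :=
  @mulg_continuous U (1, 1) [set u | A (a * b * hnn_emb u)].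
  by rewrite /= mulg1.
have [V' nV' VV'] := hnn_conj_nbhs b nV.
exists ([set a * hnn_emb v | v in V'], [set b * hnn_emb v | v in W]) => /=.
  by split; apply: hnn_nbhs_coset.
move=> [_ _] [/= [v /VV'[v' Vv' e] <-] [w Ww <-]].
have := VWA (v', w) (conj Vv' Ww); rewrite /= hnn_embM -e conjgE.
by rewrite !mulgA mulgK.
Qed.

Let hnn_inv_continuous : continuous (fun x : hnn => (x^-1 : hnn)).
Proof.
move=> a A /= /hnn_nbhsE nA.
have [|V nV VA] := @hnn_conj_nbhs a^-1 [set u | A (a^-1 * hnn_emb u^-1)].
  have := @invg_continuous U 1 [set u | A (a^-1 * hnn_emb u)].
  by rewrite /= invg1; apply.
apply: filterS (hnn_nbhs_coset a nV) => _ [v /VA[v' /= Av' e] <-] /=.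
have hV : hnn_emb v'^-1 = (hnn_emb v')^-1 by apply: gmulfV.
move: Av'; rewrite hV -e; congr A.
by rewrite conjgE invgK !invgM invgK !mulgA mulVg mul1g.
Qed.

HB.instance Definition _ := PreTopologicalGroup_isTopologicalGroup.Build hnn
  hnn_mul_continuous hnn_inv_continuous.

(* Any group topology on [hnn], presented as a topological group [K] with the
   same underlying group, that makes [hnn_emb] continuous and open. *)
Lemma hnn_topology_unique (K : topologicalGroupType)
    (f : UMagmaMorphism.type hnn K) :
  bijective f -> continuous (f \o hnn_emb) ->
  (forall V : set U, open V -> open ((f \o hnn_emb) @` V)) ->
  forall A : set K, open A <-> open (f @^-1` A).
Proof.
move=> [g fK gK] fc fo A; split=> oA.
  move=> h; rewrite (_ : mkset _ =
    [set u | [set k | A (f h * k)] ((f \o hnn_emb) u)]).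
    apply: (open_comp (f := f \o hnn_emb)) => [u _|]; first exact: fc.
    exact: mulgl_open.
  by apply/seteqP; split=> u /=; rewrite gmulfM.
rewrite openE => k Ak; rewrite -[k]gK in Ak *.
have := oA (g k); set V := mkset _ => oV.
have V1 : V 1 by rewrite /V /= gmulf1 mulg1.
have := @mulgl_open K (f (g k))^-1 _ (fo _ oV).
rewrite openE => /(_ (f (g k))) /= h.
have {h} : nbhs (f (g k)) [set x | ((f \o hnn_emb) @` V) ((f (g k))^-1 * x)].
  by apply: h; exists 1; rewrite //= !gmulf1 mulVg.
apply: filterS => x /= [v Vv e].
by move: Vv; rewrite /V /= gmulfM e mulVKg.
Qed.

End HNN.

Arguments hnn X {U} phi.
Arguments hnn_emb X {U} phi u.
Arguments hnn_free {X U} phi f.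

(* A presentation <X | R> is given by its finite set of generators [X] and its
   (possibly infinite) set of relators [R], a subset of the free group on [X]. *)
Section Generalisable.
Variables (X : finType) (R : set (free_group X)).
Variables (U : topologicalGroupType) (phi : contOpenMono U U).

Definition gen_pres_group := nquot (hnn_free phi @` R).
HB.instance Definition _ := TopologicalGroup.on gen_pres_group.

Definition gen_pres_proj : hnn X phi -> gen_pres_group :=
  nproj (hnn_free phi @` R).

Definition generalisable := injective (gen_pres_proj \o hnn_emb X phi).

End Generalisable.

Arguments gen_pres_group {X} R {U} phi.
Arguments gen_pres_proj {X} R {U} phi h.
Arguments generalisable {X} R {U} phi.

(* Main.v *)
(* In G_phi conjugation by x^n sends the image of u to that of phi^n(u); since
   x^n = 1 there, injectivity of U -> G_phi gives phi^n = id, so phi is onto. *)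
Require Import Defs.
From mathcomp Require Import all_boot.
From mathcomp Require Import all_classical topology.

Set Implicit Arguments.
Unset Strict Implicit.
Unset Printing Implicit Defensive.

Local Open Scope classical_set_scope.
Local Open Scope group_scope.

(** Iterating [hnn_conj] gives x^n u = phi^n(u) x^n in the HNN group ([hnn_free_expg_emb]). The
    relator x^n dies in G_phi ([gen_pres_proj_rel]), so u and phi^n(u) have the same image there.
    Injectivity would force phi^n = id, making phi onto. *)

Section GenPresGroup.
Variables (X : finType) (R : set (free_group X)).
Variables (U : topologicalGroupType) (phi : contOpenMono U U).

Lemma gen_pres_projM : {morph gen_pres_proj R phi : g h / g * h}.
Proof. exact: gmulfM. Qed.

Lemma gen_pres_proj1 : gen_pres_proj R phi 1 = 1.
Proof. exact: gmulf1. Qed.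

Lemma gen_pres_proj_rel (r : free_group X) :
  R r -> gen_pres_proj R phi (hnn_free phi r) = 1.
Proof.
move=> Rr; rewrite -gen_pres_proj1; apply/esym/nprojP.
by rewrite invg1 mul1g; apply: sub_normal_closure; exists r.
Qed.

(** Each letter x moved past U applies phi once. With no inverses, killing x^k leaves just the
    images of u and phi^k(u). *)
Lemma hnn_free_expg_emb (x : X) (k : nat) (u : U) :
  hnn_free phi (fgen x ^+ k) * hnn_emb X phi u =
  hnn_emb X phi (iter k phi u) * hnn_free phi (fgen x ^+ k).
Proof.
elim: k => [|k IH] /=; first by rewrite expg0 gmulf1 mul1g mulg1.
by rewrite expgS gmulfM -mulgA IH -(hnn_conj phi x) !mulgA mulgVK.
Qed.

End GenPresGroup.

Theorem proposition3p22 (U : topologicalGroupType) (phi : contOpenMono U U)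
    (X : finType) (R : set (free_group X)) (x : X) (n : nat)
    (U_hausdorff : hausdorff_space U)
    (phi_not_surj : range phi <> [set: U])
    (n_ge2 : (2 <= n)%N)
    (R_xn : R (fgen x ^+ n)) :
  ~ generalisable R phi.
Proof.
move=> emb_inj; apply: phi_not_surj; apply/seteqP; split=> // u _.
(* From here the exponent is [n.+1], so u = phi(phi^n(u)) exhibits a preimage of u. *)
case: n n_ge2 R_xn => // n _ R_xn; exists (iter n phi u) => //.
rewrite -[LHS]/(iter n.+1 phi u); apply/emb_inj/esym.
have := congr1 (gen_pres_proj R phi) (hnn_free_expg_emb phi x n.+1 u).
by rewrite !gen_pres_projM (gen_pres_proj_rel _ R_xn) mul1g mulg1.
Qed.
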